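(* Let $S$ and $T$ be automaton semigroups, each containing at least one idempotent. Then the (semigroup) free product $S\star T$ is an automaton semigroup.
   Context: An automaton is a triple $\mathcal{A}=(Q,B,\delta)$ where $Q$ is a finite set of states, $B$ is a finite alphabet of symbols, and $\delta$ is a transformation of $Q\times B$ (a map $Q\times B\to Q\times B$). Each state $q\in Q$ acts on the right on the set $B^*$ of finite words over $B$: for $\alpha=\alpha_1\alpha_2\cdots\alpha_n\in B^*$, $\alpha\cdot q=\beta_1\beta_2\cdots\beta_n$ where $q_0=q$ and $(q_{i-1},\alpha_i)\delta=(q_i,\beta_i)$ for $i=1,\dots,n$. A non-empty word $w=w_1\cdots w_m\in Q^+$ acts by $\alpha\cdot w=(\cdots((\alpha\cdot w_1)\cdot w_2)\cdots)\cdot w_m$. Regarding $B^*$ as a rooted tree (the children of $\alpha$ are the words $\alpha b$, $b\in B$), this gives a homomorphism $\phi:Q^+\to\operatorname{End}B^*$ to the endomorphism semigroup of the tree (maps written on the right); its image is denoted $\Sigma(\mathcal{A})$. A semigroup $S$ is an automaton semigroup if there is an automaton $\mathcal{A}$ with $S\simeq\Sigma(\mathcal{A})$. The free product $S\star T$ of semigroups $S=\langle X_1\mid R_1\rangle$ and $T=\langle X_2\mid R_2\rangle$ (semigroup presentations with $X_1,X_2$ disjoint) is the semigroup with presentation $\langle X_1\cup X_2\mid R_1\cup R_2\rangle$, i.e. the coproduct in the category of semigroups. *)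

(* Defs.v *)
From HB Require Import structures.
From mathcomp Require Import all_boot boolp.

Set Implicit Arguments.
Unset Strict Implicit.
Unset Printing Implicit Defensive.

Local Open Scope group_scope.
Local Open Scope quotient_scope.

Definition isomorphic (S T : semigroupType) : Prop :=
  exists f : {multiplicative S -> T}, bijective f.

Definition has_idempotent (S : semigroupType) : Prop :=
  exists e : S, e * e = e.

(* The free semigroup [X^+]: non-empty words under concatenation. *)
Definition freesg (X : Type) : Type := {w : seq X | ~~ nilp w}.

Section FreeSemigroup.
Variable X : choiceType.

HB.instance Definition _ := Choice.on (freesg X).

Fact freesg_mul_subproof (u v : freesg X) : ~~ nilp (val u ++ val v).
Proof. by case: u => -[]. Qed.

Definition freesg_mul (u v : freesg X) : freesg X :=
  Sub (val u ++ val v) (freesg_mul_subproof u v).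

Fact freesg_mulA : associative freesg_mul.
Proof. by move=> u v w; apply: val_inj; rewrite /= catA. Qed.

HB.instance Definition _ := isSemigroup.Build (freesg X) freesg_mulA.

Definition freesg_gen (x : X) : freesg X := Sub [:: x] isT.

Lemma freesg_induction (P : freesg X -> Prop) :
  (forall x, P (freesg_gen x)) ->
  (forall x u, P u -> P (freesg_gen x * u)) -> forall u, P u.
Proof.
move=> P1 PM [[//|x w] wP]; elim: w x wP => [|y w IHw] x wP.
  by rewrite (_ : exist _ _ _ = freesg_gen x) //; apply: val_inj.
pose u : freesg X := exist _ (y :: w) isT.
rewrite (_ : exist _ _ _ = freesg_gen x * u); last exact: val_inj.
exact/PM/IHw.
Qed.

Section Eval.
Variables (U : semigroupType) (f : X -> U).

Fixpoint eval_seq (x : X) (w : seq X) : U :=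
  if w is y :: w' then f x * eval_seq y w' else f x.

Definition freesg_eval (u : freesg X) : U :=
  match u with
  | exist (x :: w) _ => eval_seq x w
  | exist [::] wP => False_rect U (elimN idP wP isT)
  end.

Lemma freesg_eval_gen x : freesg_eval (freesg_gen x) = f x.
Proof. by []. Qed.

Lemma freesg_evalM u v : freesg_eval (u * v) = freesg_eval u * freesg_eval v.
Proof.
case: u v => -[//|x u] uP [[//|y v] vP] /=.
by elim: u x uP => [//|z u IHu] x uP /=; rewrite IHu // mulgA.
Qed.

HB.instance Definition _ :=
  isMultiplicative.Build (freesg X) U freesg_eval freesg_evalM.

End Eval.

Lemma freesg_mult_ext (U : semigroupType)
    (g h : {multiplicative freesg X -> U}) :
  (forall x, g (freesg_gen x) = h (freesg_gen x)) -> g =1 h.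
Proof.
by move=> gh; elim/freesg_induction=> // x u IHu; rewrite !gmulfM IHu gh.
Qed.

End FreeSemigroup.

Section FreeSemigroupMap.
Variables (X Y : choiceType) (f : X -> Y).

Fact freesg_map_subproof (u : freesg X) : ~~ nilp (map f (val u)).
Proof. by case: u => -[]. Qed.

Definition freesg_map (u : freesg X) : freesg Y :=
  Sub (map f (val u)) (freesg_map_subproof u).

Fact freesg_mapM (u v : freesg X) :
  freesg_map (u * v) = freesg_map u * freesg_map v.
Proof. by apply: val_inj; rewrite /= map_cat. Qed.

HB.instance Definition _ :=
  isMultiplicative.Build (freesg X) (freesg Y) freesg_map freesg_mapM.

Lemma freesg_map_gen x : freesg_map (freesg_gen x) = freesg_gen (f x).
Proof. exact: val_inj. Qed.

End FreeSemigroupMap.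

Section Presentation.
Variables (X : choiceType) (R : freesg X -> freesg X -> Prop).

Inductive gen_congr : freesg X -> freesg X -> Prop :=
| GenRel u v : R u v -> gen_congr u v
| GenRefl u : gen_congr u u
| GenSym u v : gen_congr u v -> gen_congr v u
| GenTrans u v w : gen_congr u v -> gen_congr v w -> gen_congr u w
| GenMul u u' v v' :
    gen_congr u u' -> gen_congr v v' -> gen_congr (u * v) (u' * v').

Definition gen_congrb : rel (freesg X) := fun u v => `[< gen_congr u v >].

Fact gen_congrb_refl : reflexive gen_congrb.
Proof. by move=> u; apply/asboolP/GenRefl. Qed.

Fact gen_congrb_sym : symmetric gen_congrb.
Proof. by move=> u v; apply/asboolP/asboolP; apply: GenSym. Qed.

Fact gen_congrb_trans : transitive gen_congrb.
Proof.
by move=> v u w /asboolP uv /asboolP vw; apply/asboolP/(GenTrans uv vw).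
Qed.

Canonical gen_congr_equiv :=
  EquivRel gen_congrb gen_congrb_refl gen_congrb_sym gen_congrb_trans.

Definition presented : Type := {eq_quot gen_congr_equiv}.

HB.instance Definition _ := Choice.on presented.
HB.instance Definition _ := EqQuotient.on presented.

Definition presented_class (u : freesg X) : presented := \pi_presented u.

Lemma presented_classP u v :
  presented_class u = presented_class v <-> gen_congr u v.
Proof.
by split=> [/eqmodP/asboolP | uv]; last exact/eqmodP/asboolP.
Qed.

Lemma presented_classK c : presented_class (repr c) = c.
Proof. exact: reprK. Qed.

Definition presented_mul (c d : presented) : presented :=
  presented_class (repr c * repr d).

Lemma presented_mulE u v :
  presented_mul (presented_class u) (presented_class v) =
  presented_class (u * v).
Proof.
by apply/presented_classP/GenMul; apply/presented_classP;
  rewrite presented_classK.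
Qed.

Fact presented_mulA : associative presented_mul.
Proof.
move=> c d e; rewrite -[c]presented_classK -[d]presented_classK.
by rewrite -[e]presented_classK !presented_mulE mulgA.
Qed.

HB.instance Definition _ := isSemigroup.Build presented presented_mulA.

Fact presented_classM u v :
  presented_class (u * v) = presented_class u * presented_class v.
Proof. by rewrite [RHS]presented_mulE. Qed.

HB.instance Definition _ :=
  isMultiplicative.Build (freesg X) presented presented_class presented_classM.

Definition presented_gen (x : X) : presented := presented_class (freesg_gen x).

Section Lift.
Variables (U : semigroupType) (f : X -> U).
Hypothesis fR : forall u v, R u v -> freesg_eval f u = freesg_eval f v.

Definition presented_lift (c : presented) : U := freesg_eval f (repr c).

Lemma presented_liftE u : presented_lift (presented_class u) = freesg_eval f u.
Proof.
suff congrE v w : gen_congr v w -> freesg_eval f v = freesg_eval f w.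
  by apply/congrE/presented_classP; rewrite presented_classK.
elim=> {v w}//.
- by move=> v w x _ -> _ ->.
- by move=> v v' w w' _ vv' _ ww'; rewrite !freesg_evalM vv' ww'.
Qed.

Lemma presented_lift_gen x : presented_lift (presented_gen x) = f x.
Proof. by rewrite presented_liftE. Qed.

Lemma presented_liftM c d :
  presented_lift (c * d) = presented_lift c * presented_lift d.
Proof.
rewrite -[c]presented_classK -[d]presented_classK -presented_classM.
by rewrite !presented_liftE freesg_evalM.
Qed.

End Lift.

Lemma presented_mult_ext (U : semigroupType)
    (g h : {multiplicative presented -> U}) :
  (forall x, g (presented_gen x) = h (presented_gen x)) -> g =1 h.
Proof.
move=> gh c; rewrite -[c]presented_classK.
exact: (freesg_mult_ext (g := g \o presented_class)
                        (h := h \o presented_class)).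
Qed.

End Presentation.

Section DisjointUnion.
Variables (X1 X2 : choiceType).
Variables (R1 : freesg X1 -> freesg X1 -> Prop).
Variables (R2 : freesg X2 -> freesg X2 -> Prop).

Inductive sum_rel : freesg (X1 + X2)%type -> freesg (X1 + X2)%type -> Prop :=
| SumRelL u v : R1 u v -> sum_rel (freesg_map inl u) (freesg_map inl v)
| SumRelR u v : R2 u v -> sum_rel (freesg_map inr u) (freesg_map inr v).

End DisjointUnion.

Inductive mul_table (S : semigroupType) : freesg S -> freesg S -> Prop :=
| MulTable s t : mul_table (freesg_gen s * freesg_gen t) (freesg_gen (s * t)).

(* Each factor is presented by all its elements and its multiplication table;
   by [free_product_presented] below, any other presentations of the factors
   give the same semigroup up to isomorphism. *)
Definition free_product (S T : semigroupType) : semigroupType :=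
  presented (sum_rel (@mul_table S) (@mul_table T)).

Lemma presented_mul_table (S : semigroupType) :
  isomorphic (presented (@mul_table S)) S.
Proof.
have fR u v : mul_table u v -> freesg_eval (@idfun S) u = freesg_eval idfun v.
  by case.
pose f := presented_lift (R := @mul_table S) (@idfun S).
pose fM : {multiplicative presented (@mul_table S) -> S} :=
  HB.pack f (isMultiplicative.Build _ _ f (presented_liftM fR)).
have gM (s t : S) : presented_gen (@mul_table S) (s * t) =
    presented_gen _ s * presented_gen _ t.
  by rewrite -gmulfM; apply/presented_classP/GenSym/GenRel/MulTable.
pose g : {multiplicative S -> presented (@mul_table S)} :=
  HB.pack (presented_gen (@mul_table S)) (isMultiplicative.Build _ _ _ gM).
exists fM, g => [c | s]; last exact: presented_lift_gen.
apply: (presented_mult_ext (g := g \o fM) (h := idfun)) => x /=.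
by rewrite /f presented_lift_gen.
Qed.

Section Coproduct.
Variables S T : semigroupType.

Definition free_inl (s : S) : free_product S T := presented_gen _ (inl s).
Definition free_inr (t : T) : free_product S T := presented_gen _ (inr t).

Fact free_inlM s s' : free_inl (s * s') = free_inl s * free_inl s'.
Proof.
rewrite -gmulfM; apply/presented_classP/GenSym/GenRel.
by rewrite -!freesg_map_gen -gmulfM; apply/SumRelL/MulTable.
Qed.

Fact free_inrM t t' : free_inr (t * t') = free_inr t * free_inr t'.
Proof.
rewrite -gmulfM; apply/presented_classP/GenSym/GenRel.
by rewrite -!freesg_map_gen -gmulfM; apply/SumRelR/MulTable.
Qed.

HB.instance Definition _ := isMultiplicative.Build S _ free_inl free_inlM.
HB.instance Definition _ := isMultiplicative.Build T _ free_inr free_inrM.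

Lemma free_product_coproduct (U : semigroupType)
    (f : {multiplicative S -> U}) (g : {multiplicative T -> U}) :
  (exists h : {multiplicative free_product S T -> U},
     h \o free_inl =1 f /\ h \o free_inr =1 g) /\
  (forall h k : {multiplicative free_product S T -> U},
     h \o free_inl =1 k \o free_inl -> h \o free_inr =1 k \o free_inr ->
     h =1 k).
Proof.
split=> [|h k hkl hkr]; last first.
  by apply: presented_mult_ext => -[s | t]; [apply: hkl | apply: hkr].
pose fg (x : S + T) := match x with inl s => f s | inr t => g t end.
have fgR u v : sum_rel (@mul_table S) (@mul_table T) u v ->
    freesg_eval fg u = freesg_eval fg v.
  by case=> _ _ [x y]; rewrite !gmulfM !freesg_map_gen /= gmulfM.
pose h := presented_lift (R := sum_rel (@mul_table S) (@mul_table T)) fg.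
exists (HB.pack_for {multiplicative free_product S T -> U} h
  (isMultiplicative.Build _ _ h (presented_liftM fgR))).
by split=> x /=; rewrite /h presented_lift_gen.
Qed.

End Coproduct.

Lemma free_product_presented (X1 X2 : choiceType)
    (R1 : freesg X1 -> freesg X1 -> Prop)
    (R2 : freesg X2 -> freesg X2 -> Prop) :
  isomorphic (presented (sum_rel R1 R2))
             (free_product (presented R1) (presented R2)).
Proof.
set P := presented (sum_rel R1 R2).
set FP := free_product (presented R1) (presented R2).
pose f0 (x : X1 + X2) : FP :=
  match x with
  | inl a => free_inl _ (presented_gen R1 a)
  | inr b => free_inr _ (presented_gen R2 b)
  end.
have f0l u : freesg_eval f0 (freesg_map inl u) =
    free_inl _ (presented_class R1 u).
  exact: (freesg_mult_ext (g := freesg_eval f0 \o freesg_map inl)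
    (h := @free_inl (presented R1) (presented R2) \o @presented_class _ R1)).
have f0r u : freesg_eval f0 (freesg_map inr u) =
    free_inr _ (presented_class R2 u).
  exact: (freesg_mult_ext (g := freesg_eval f0 \o freesg_map inr)
    (h := @free_inr (presented R1) (presented R2) \o @presented_class _ R2)).
have f0R u v : sum_rel R1 R2 u v -> freesg_eval f0 u = freesg_eval f0 v.
  by case=> {}u {}v uv; rewrite ?f0l ?f0r; congr (_ _);
    apply/presented_classP/GenRel.
pose f : {multiplicative P -> FP} :=
  HB.pack_for {multiplicative P -> FP} (presented_lift (R := sum_rel R1 R2) f0)
    (isMultiplicative.Build _ _ _ (presented_liftM f0R)).
pose l0 a : P := presented_gen _ (inl a).
pose r0 b : P := presented_gen _ (inr b).
have l0E u : freesg_eval l0 u = presented_class _ (freesg_map inl u).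
  apply: (freesg_mult_ext (g := freesg_eval l0)
    (h := @presented_class _ (sum_rel R1 R2) \o freesg_map inl)) => x /=.
  by rewrite freesg_map_gen.
have r0E u : freesg_eval r0 u = presented_class _ (freesg_map inr u).
  apply: (freesg_mult_ext (g := freesg_eval r0)
    (h := @presented_class _ (sum_rel R1 R2) \o freesg_map inr)) => x /=.
  by rewrite freesg_map_gen.
have l0R u v : R1 u v -> freesg_eval l0 u = freesg_eval l0 v.
  by move=> uv; rewrite !l0E; apply/presented_classP/GenRel/SumRelL.
have r0R u v : R2 u v -> freesg_eval r0 u = freesg_eval r0 v.
  by move=> uv; rewrite !r0E; apply/presented_classP/GenRel/SumRelR.
pose l : {multiplicative presented R1 -> P} :=
  HB.pack_for {multiplicative presented R1 -> P} (presented_lift (R := R1) l0)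
    (isMultiplicative.Build _ _ _ (presented_liftM l0R)).
pose r : {multiplicative presented R2 -> P} :=
  HB.pack_for {multiplicative presented R2 -> P} (presented_lift (R := R2) r0)
    (isMultiplicative.Build _ _ _ (presented_liftM r0R)).
have [[g [gl gr]] _] := free_product_coproduct l r.
have gfl x : g (free_inl _ (presented_gen R1 x)) = l0 x.
  by rewrite [LHS]gl /= presented_lift_gen.
have gfr x : g (free_inr _ (presented_gen R2 x)) = r0 x.
  by rewrite [LHS]gr /= presented_lift_gen.
exists f, g.
  apply: (presented_mult_ext (g := g \o f) (h := idfun)) => -[x | x].
    exact: etrans (congr1 g (presented_lift_gen f0R (inl x))) (gfl x).
  exact: etrans (congr1 g (presented_lift_gen f0R (inr x))) (gfr x).
have [_ uniq] := free_product_coproduct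
  (@free_inl (presented R1) (presented R2))
  (@free_inr (presented R1) (presented R2)).
apply: (uniq (f \o g) idfun).
  apply: (presented_mult_ext
    (g := (f \o g) \o @free_inl (presented R1) (presented R2))
    (h := @free_inl (presented R1) (presented R2))) => x.
  exact: etrans (congr1 f (gfl x)) (presented_lift_gen f0R (inl x)).
apply: (presented_mult_ext
  (g := (f \o g) \o @free_inr (presented R1) (presented R2))
  (h := @free_inr (presented R1) (presented R2))) => x.
exact: etrans (congr1 f (gfr x)) (presented_lift_gen f0R (inr x)).
Qed.

Record automaton := Automaton {
  state : finType;
  symbol : finType;
  trans : state * symbol -> state * symbol
}.

Section TreeEndomorphisms.
Variable B : finType.

(* The children of [a] in the rooted tree are the words [rcons a b]. *)
Definition is_tree_endo (f : seq B -> seq B) : Prop :=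
  f [::] = [::] /\ forall a b, exists c, f (rcons a b) = rcons (f a) c.

Definition tree_endo : Type := {f : seq B -> seq B | `[< is_tree_endo f >]}.

HB.instance Definition _ := SubChoice.on tree_endo.

Fact tree_endo_mul_subproof (f g : tree_endo) :
  `[< is_tree_endo (val g \o val f) >].
Proof.
apply/asboolP; case: f g => [f /asboolP[f0 fS]] [g /asboolP[g0 gS]] /=.
split=> [|a b] /=; first by rewrite f0.
by have [c ->] := fS a b; apply: gS.
Qed.

(* Maps are written on the right: [f * g] is [f] followed by [g]. *)
Definition tree_endo_mul (f g : tree_endo) : tree_endo :=
  Sub (val g \o val f) (tree_endo_mul_subproof f g).

Fact tree_endo_mulA : associative tree_endo_mul.
Proof. by move=> f g h; apply: val_inj. Qed.

HB.instance Definition _ := isSemigroup.Build tree_endo tree_endo_mulA.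

End TreeEndomorphisms.

Section AutomatonSemigroup.
Variable A : automaton.

Fixpoint state_act (q : state A) (a : seq (symbol A)) : seq (symbol A) :=
  if a is b :: a' then
    let: (r, c) := trans (q, b) in c :: state_act r a'
  else [::].

Fact state_act_endo q : `[< is_tree_endo (state_act q) >].
Proof.
apply/asboolP; split=> // a; elim: a q => [|x a IHa] q b /=.
  by case: (trans _) => r c; exists c.
case: (trans _) => r c; have [d ->] := IHa r b.
by exists d.
Qed.

Definition state_endo (q : state A) : tree_endo (symbol A) :=
  Sub (state_act q) (state_act_endo q).

Definition word_endo : freesg (state A) -> tree_endo (symbol A) :=
  freesg_eval state_endo.

HB.instance Definition _ := Multiplicative.on word_endo.

Lemma word_endoE (w : freesg (state A)) (a : seq (symbol A)) :
  val (word_endo w) a = foldl (fun b q => state_act q b) a (val w).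
Proof.
elim/freesg_induction: w a => // q w IHw a.
by rewrite /word_endo gmulfM /= -/(word_endo w) IHw.
Qed.

Definition in_image (f : tree_endo (symbol A)) : Prop :=
  exists w, word_endo w = f.

(* The semigroup usually written Sigma(A). *)
Definition automaton_sg : Type :=
  {f : tree_endo (symbol A) | `[< in_image f >]}.

HB.instance Definition _ := SubChoice.on automaton_sg.

Fact automaton_sg_closed :
  mulg_closed [pred f : tree_endo (symbol A) | `[< in_image f >]].
Proof.
move=> _ _ /asboolP[u <-] /asboolP[v <-]; apply/asboolP.
by exists (u * v); rewrite gmulfM.
Qed.

HB.instance Definition _ :=
  SubChoice_isSubSemigroup.Build _ _ automaton_sg automaton_sg_closed.

Lemma automaton_sg_mulE (f g : automaton_sg) : val (f * g) = val f * val g.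
Proof. exact: gmulfM. Qed.

End AutomatonSemigroup.

Definition is_automaton_semigroup (S : semigroupType) : Prop :=
  exists A : automaton, isomorphic S (automaton_sg A).

(* Main.v *)
Require Import Defs.
From HB Require Import structures.
From mathcomp Require Import all_boot boolp.

Set Implicit Arguments.
Unset Strict Implicit.
Unset Printing Implicit Defensive.

Local Open Scope group_scope.

(** Automata are first traded for faithful self-similar actions: [S] is an
    automaton semigroup iff, for some finite alphabet [D], there is a
    homomorphism from [S] to the wreath product of [S] with the transformations
    of [D] (each element gets an action on letters and, at each letter, a
    section in [S]) such that the induced action on words is faithful and some
    finite generating set is closed under sections
    ([automaton_self_similar], [self_similar_automaton]).  In this form a
    generating set may be enlarged freely, so an idempotent [e] of [S] can be
    assumed to be one of the states ([section_closed_ext]), and an action of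
    the free product is defined by its universal property from homomorphisms
    on [S] and on [T].

    The letters for the free product are letters of either factor, or one of
    two separators, each carrying a phase.  The phase records which syllables
    of an alternating product [s1 t1 s2 t2 ...] have already gone through: an
    element of [T] moves [Before] to [InT], an element of [S] moves [InT] to
    [InS], and a further element of [T] moves [InS] to [After]; nothing else
    changes.  A syllable acts on a letter of its own factor, as that factor
    does, precisely when it leaves the letter in its own phase; its section at
    a separator in its own phase is [e].  Otherwise it passes with itself as
    section.  So two consecutive elements of one factor behave as their
    product, the only relation used at a separator being [e * e = e].

    For faithfulness, let [x] be [e t1 s2 t2 s3 ...].  On a block of letters of
    [S] in phase [Before], closed by its separator, only [s2] acts, which
    recovers [s2], and the section is [e t1 e t2 s3 ...].  On a similar block
    of letters of [T], this section shows the action of [t1], and its own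
    section is [e e e t2 s3 ... = e t2 s3 ...], which is shorter: by induction
    the action of [x] determines its syllables ([faithful_extend]).  A product
    that starts in [T] is read off after multiplying by [e] on the left; for
    one that starts in [S], a block in phase [InT] shows the first syllable and
    has a section that starts with [e].  One more letter, the probe, remembers
    which factor moved it first, and so tells these two cases apart. *)

(** * Self-similar actions *)

Section Wreath.
Variables (D : finType) (X : semigroupType).

(** A transformation of [D] together with an element of [X] at each letter; the
    product is that of transition maps of automata composed in series. *)
Definition wreath : Type := {ffun D -> D * X}.

HB.instance Definition _ := Choice.on wreath.

Definition wreath_mul (F G : wreath) : wreath :=
  [ffun d => ((G (F d).1).1, (F d).2 * (G (F d).1).2)].

Fact wreath_mulA : associative wreath_mul.
Proof. by move=> F G H; apply/ffunP=> d; rewrite /wreath_mul !ffunE /= mulgA. Qed.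

HB.instance Definition _ := isSemigroup.Build wreath wreath_mulA.

Lemma wreath_mulE (F G : wreath) d :
  (F * G : wreath) d = ((G (F d).1).1, (F d).2 * (G (F d).1).2).
Proof. exact: ffunE. Qed.

End Wreath.

Section SelfSimilar.
Variables (D : finType) (S : semigroupType).
Variable rho : {multiplicative S -> wreath D S}.

Fixpoint act (s : S) (w : seq D) : seq D :=
  if w is d :: w' then (rho s d).1 :: act (rho s d).2 w' else [::].

Fixpoint sect (s : S) (w : seq D) : S :=
  if w is d :: w' then sect (rho s d).2 w' else s.

Definition faithful := forall s t, act s =1 act t -> s = t.

Definition section_closed (Q : seq S) :=
  forall q d, q \in Q -> (rho q d).2 \in Q.

Lemma actM s t w : act (s * t) w = act t (act s w).
Proof.
elim: w s t => //= d w IHw s t.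
by rewrite gmulfM wreath_mulE /= IHw.
Qed.

Lemma sectM s t w : sect (s * t) w = sect s w * sect t (act s w).
Proof.
elim: w s t => //= d w IHw s t.
by rewrite gmulfM wreath_mulE /= IHw.
Qed.

Lemma act_cat s v w : act s (v ++ w) = act s v ++ act (sect s v) w.
Proof. by elim: v s => //= d v IHv s; rewrite IHv. Qed.

Lemma act_endo s : `[< is_tree_endo (act s) >].
Proof.
apply/asboolP; split=> // w b; rewrite -!cats1 act_cat /=.
by eexists; rewrite cats1.
Qed.

Lemma size_act s w : size (act s w) = size w.
Proof. by elim: w s => //= d w IHw s; rewrite IHw. Qed.

(** As an automaton, [s] reads [w], writes [w'] and ends in state [s']. *)
Definition runs s w w' s' := act s w = w' /\ sect s w = s'.

Lemma runsM s t w w1 w2 s' t' :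
  runs s w w1 s' -> runs t w1 w2 t' -> runs (s * t) w w2 (s' * t').
Proof. by move=> [sw sw'] [tw tw']; split; rewrite ?actM ?sectM sw ?sw' ?tw'. Qed.

(** Since actions preserve lengths, elements with the same action have sections
    with the same action: the kernel of the action can be explored by reading
    words. *)
Lemma kernel_section s t w w1 w2 s' t' : act s =1 act t ->
  runs s w w1 s' -> runs t w w2 t' -> w1 = w2 /\ act s' =1 act t'.
Proof.
move=> st [<- <-] [<- <-]; split=> [|v]; first exact: st.
have := st (w ++ v); rewrite !act_cat => /eqP.
by rewrite eqseq_cat ?size_act // => /andP[_ /eqP].
Qed.

End SelfSimilar.

(** Generation as an induction principle: adding generators on the left. *)
Definition generates (S : semigroupType) (Q : seq S) : Prop :=
  forall P : S -> Prop,
    (forall q, q \in Q -> P q) ->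
    (forall q s, q \in Q -> P s -> P (q * s)) -> forall s, P s.

Definition self_similar (S : semigroupType) : Prop :=
  exists (D : finType) (rho : {multiplicative S -> wreath D S}) (Q : seq S),
    [/\ generates Q, section_closed rho Q & faithful rho].

(** * Automaton semigroups as self-similar semigroups *)

Lemma word_endo_cons (A : automaton) (q : state A) v w :
  val (word_endo (freesg_gen q * v)) w = val (word_endo v) (state_act q w).
Proof. by rewrite gmulfM. Qed.

(** The section at a letter of the action of a word of states is again the
    action of a word of states, so it lies in the semigroup; being determined
    by the action alone, it does not depend on the word, which makes the map to
    the wreath product multiplicative. *)
Lemma automaton_self_similar (S : semigroupType) :
  is_automaton_semigroup S -> self_similar S.
Proof.
case=> A [f [g fK gK]].
pose D := symbol A.
have [phi phiE] : exists phi : S -> D -> D * S, forall s d w,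
    val (val (f s)) (d :: w) = (phi s d).1 :: val (val (f (phi s d).2)) w.
  have word_sect (v : freesg (state A)) (d : D) : exists p : D * freesg (state A),
      forall w, val (word_endo v) (d :: w) = p.1 :: val (word_endo p.2) w.
    elim/freesg_induction: v d => [q | q v IHv] d.
      exists ((trans (q, d)).2, freesg_gen (trans (q, d)).1) => w.
      by rewrite !word_endoE /=; case: (trans _).
    have [[d' v'] /= vE] := IHv (trans (q, d)).2.
    exists (d', freesg_gen (trans (q, d)).1 * v') => w.
    rewrite !word_endo_cons /=.
    by case: (trans _) vE => r c /= vE; rewrite vE.
  suff phi_ex (sd : S * D) : exists p : D * S, forall w,
      val (val (f sd.1)) (sd.2 :: w) = p.1 :: val (val (f p.2)) w.
    have [phi phiE] := choice phi_ex.
    by exists (fun s d => phi (s, d)) => s d; apply: (phiE (s, d)).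
  case: sd => s d /=; have /asboolP[v vE] := valP (f s).
  have [[d' v'] vE'] := word_sect v d.
  have v'P : `[< in_image (word_endo v') >] by apply/asboolP; exists v'.
  exists (d', g (Sub (word_endo v') v'P)) => w /=.
  by rewrite gK -vE vE'.
pose r s : wreath D S := finfun (phi s).
have phi_uniq s d p : (forall w, val (val (f s)) (d :: w) =
    p.1 :: val (val (f p.2)) w) -> phi s d = p.
  move=> pE; have eqp w := etrans (esym (phiE s d w)) (pE w).
  rewrite [LHS]surjective_pairing [RHS]surjective_pairing.
  have [-> _] := eqp [::]; congr (_, _); apply: (can_inj fK).
  by do 2![apply: val_inj]; apply: funext => w; case: (eqp w).
have rM s t : r (s * t) = r s * r t.
  apply/ffunP=> d; rewrite wreath_mulE !ffunE; apply: phi_uniq => w.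
  by rewrite !gmulfM /= !phiE.
pose rho : {multiplicative S -> wreath D S} :=
  HB.pack_for {multiplicative S -> wreath D S} r (isMultiplicative.Build _ _ r rM).
have gen_image (q : state A) : `[< in_image (state_endo q) >].
  by apply/asboolP; exists (freesg_gen q).
pose st (q : state A) : S := g (Sub (state_endo q) (gen_image q)).
exists D, rho, [seq st q | q <- enum (state A)]; split.
- move=> P P1 PM s.
  have stQ q : st q \in [seq st q | q <- enum (state A)].
    by apply: map_f; rewrite mem_enum.
  have /asboolP[v vE] := valP (f s).
  elim/freesg_induction: v s vE => [q | q v IHv] s vE.
    suff -> : s = st q by apply/P1/stQ.
    by apply: (can_inj fK); apply: val_inj; rewrite gK -vE.
  have vP : `[< in_image (word_endo v) >] by apply/asboolP; exists v.
  suff -> : s = st q * g (Sub (word_endo v) vP).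
    by apply: PM (stQ q) (IHv _ _); rewrite gK.
  apply: (can_inj fK); apply: val_inj.
  by rewrite gmulfM !gK -vE automaton_sg_mulE gmulfM.
- move=> _ d /mapP[q _ ->]; apply/mapP.
  exists (trans (q, d)).1; first by rewrite mem_enum.
  suff -> : rho (st q) d = ((trans (q, d)).2, st (trans (q, d)).1) by [].
  rewrite ffunE; apply: phi_uniq => w; rewrite /st !gK /=.
  by case: (trans _).
- move=> s t st_eq; apply: (can_inj fK); do 2![apply: val_inj].
  have actE u w : val (val (f u)) w = act rho u w.
    elim: w u => [|d w IHw] u.
      by have /asboolP[] := valP (val (f u)).
    by rewrite phiE IHw /= ffunE.
  by apply: funext => w; rewrite !actE.
Qed.

(** The states of the automaton are the elements of the section-closed
    generating set. *)
Lemma self_similar_automaton (S : semigroupType) :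
  self_similar S -> is_automaton_semigroup S.
Proof.
case=> D [rho [Q [genQ closedQ faithfulQ]]].
pose tr (p : seq_sub Q * D) : seq_sub Q * D :=
  (SeqSub (closedQ _ p.2 (valP p.1)), (rho (val p.1) p.2).1).
pose A := Automaton tr.
pose endo s : tree_endo D := Sub (act rho s) (act_endo rho s).
have endoM s t : endo (s * t) = endo s * endo t.
  by apply: val_inj; apply: funext => w /=; rewrite actM.
have endo_gen (q : state A) : state_endo q = endo (val q).
  apply: val_inj; apply: funext => w /=.
  by elim: w q => //= d w IHw q; rewrite IHw.
have endoP s : `[< in_image (endo s : tree_endo (symbol A)) >].
  apply/asboolP; elim/genQ: s => [q Qq | q s Qq [v vE]].
    exists (freesg_gen (SeqSub Qq : state A)).
    by rewrite -[LHS]/(state_endo _) endo_gen.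
  exists (freesg_gen (SeqSub Qq : state A) * v).
  rewrite endoM -vE -(endo_gen (SeqSub Qq)); exact: gmulfM.
pose F s : automaton_sg A := Sub (endo s) (endoP s).
have FM s t : F (s * t) = F s * F t.
  by apply: val_inj; rewrite automaton_sg_mulE /= endoM.
exists A, (HB.pack_for {multiplicative S -> automaton_sg A} F
             (isMultiplicative.Build _ _ F FM)) => /=.
have F_surj x : exists s, F s = x.
  have /asboolP[v vE] := valP x; elim/freesg_induction: v x vE => [q|q v IHv] x vE.
    by exists (val q); apply: val_inj; rewrite -vE /= -endo_gen.
  have vP : `[< in_image (word_endo v) >] by apply/asboolP; exists v.
  have [s sE] := IHv (Sub (word_endo v) vP) erefl.
  exists (val q * s); apply: val_inj; rewrite -vE gmulfM /= endoM -endo_gen.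
  by congr (_ * _); rewrite -[LHS]/(val (F s)) sE.
have [G GK] := choice F_surj.
exists G => // s; apply: faithfulQ => w.
by rewrite -[LHS]/(val (val (F _)) w) GK.
Qed.

(** Sections of a product of [n] generators are products of [n] generators, of
    which there are finitely many. *)
Lemma section_closed_ext (D : finType) (S : semigroupType)
    (rho : {multiplicative S -> wreath D S}) (Q : seq S) :
  generates Q -> section_closed rho Q ->
  forall s, exists2 Q' : seq S, s \in Q' & section_closed rho Q'.
Proof.
move=> genQ closedQ; elim/genQ => [q Qq | q s Qq [Y Ys closedY]]; first by exists Q.
exists [seq x * y | x <- Q, y <- Y]; first exact: allpairs_f.
move=> _ d /allpairsP[[x y] /= [Qx Yy ->]].
by rewrite gmulfM wreath_mulE; apply: allpairs_f; [apply: closedQ | apply: closedY].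
Qed.

(** * The action of the free product *)

Inductive phase := Before | InT | InS | After.

Definition phase_code k : bool * bool :=
  match k with
  | Before => (false, false) | InT => (false, true)
  | InS => (true, false) | After => (true, true)
  end.

Definition phase_decode (c : bool * bool) : phase :=
  match c with
  | (false, false) => Before | (false, true) => InT
  | (true, false) => InS | (true, true) => After
  end.

Lemma phase_codeK : cancel phase_code phase_decode. Proof. by case. Qed.

HB.instance Definition _ := Finite.copy phase (can_type phase_codeK).

Definition nextS k :=
  match k with Before => Before | InT | InS => InS | After => After end.

Definition nextT k :=
  match k with Before | InT => InT | InS | After => After end.

Lemma free_product_ind (S T : semigroupType) (P : free_product S T -> Prop) :
  (forall s, P (free_inl T s)) -> (forall t, P (free_inr S t)) ->
  (forall s x, P x -> P (free_inl T s * x)) ->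
  (forall t x, P x -> P (free_inr S t * x)) -> forall x, P x.
Proof.
move=> PS PT PSM PTM x; rewrite -[x]presented_classK.
elim/freesg_induction: (repr x) => [[s|t] | [s|t] u Pu].
- exact: PS.
- exact: PT.
- by rewrite gmulfM; apply: PSM.
- by rewrite gmulfM; apply: PTM.
Qed.

Lemma free_product_generates (S T : semigroupType) (QS : seq S) (QT : seq T) :
  generates QS -> generates QT ->
  generates ([seq free_inl T s | s <- QS] ++ [seq free_inr S t | t <- QT]).
Proof.
move=> genS genT P P1 PM.
have inS q : q \in QS -> free_inl T q \in
    [seq free_inl T s | s <- QS] ++ [seq free_inr S t | t <- QT].
  by move=> Qq; rewrite mem_cat map_f.
have inT q : q \in QT -> free_inr S q \in
    [seq free_inl T s | s <- QS] ++ [seq free_inr S t | t <- QT].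
  by move=> Qq; rewrite mem_cat (map_f _ Qq) orbT.
apply: free_product_ind => [s | t | s | t].
- elim/genS: s => [q Qq | q s Qq Ps]; first exact/P1/inS.
  by rewrite gmulfM; apply: PM => //; apply: inS.
- elim/genT: t => [q Qq | q t Qq Pt]; first exact/P1/inT.
  by rewrite gmulfM; apply: PM => //; apply: inT.
- elim/genS: s => [q Qq | q s Qq IHs] x Px; first by apply: PM => //; apply: inS.
  by rewrite gmulfM -mulgA; apply: PM; [apply: inS | apply: IHs].
- elim/genT: t => [q Qq | q t Qq IHt] x Px; first by apply: PM => //; apply: inT.
  by rewrite gmulfM -mulgA; apply: PM; [apply: inT | apply: IHt].
Qed.

Section FreeProduct.
Variables (S T : semigroupType) (DS DT : finType).
Variables (rS : {multiplicative S -> wreath DS S}).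
Variables (rT : {multiplicative T -> wreath DT T}).
Variables (e : S) (ee : e * e = e).

Local Notation FP := (free_product S T).
Local Notation inS := (@free_inl S T).
Local Notation inT := (@free_inr S T).

(** [inl None] and [inr None] are the separators closing blocks of letters of
    [S] and of [T]. *)
Definition content : finType := (option DS + option DT)%type.
(** [inr None] is the probe; [inr (Some b)] is a probe first read by an element
    of [S] if [b], of [T] otherwise. *)
Definition letter : finType := (content * phase + option bool)%type.

Definition stepS (s : S) : wreath letter FP := [ffun d =>
  match d with
  | inl (c, k) =>
    match nextS k, c with
    | InS, inl (Some a) => (inl (inl (Some (rS s a).1), InS), inS (rS s a).2)
    | InS, inl None => (inl (c, InS), inS e)
    | k', _ => (inl (c, k'), inS s)
    end
  | inr b => (inr (Some (odflt true b)), inS s)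
  end].

(** The section at the separator is again [e], in [S], and not an idempotent of
    [T]: in a product [e t e], replacing [t] in this way merges the three
    syllables into one. *)
Definition stepT (t : T) : wreath letter FP := [ffun d =>
  match d with
  | inl (c, k) =>
    match nextT k, c with
    | InT, inr (Some b) => (inl (inr (Some (rT t b).1), InT), inT (rT t b).2)
    | InT, inr None => (inl (c, InT), inS e)
    | k', _ => (inl (c, k'), inT t)
    end
  | inr b => (inr (Some (odflt false b)), inT t)
  end].

Fact stepSM s s' : stepS (s * s') = stepS s * stepS s'.
Proof.
apply/ffunP=> d; rewrite wreath_mulE !ffunE.
case: d => [[[[a|]|c] []]|b] //=;
  by rewrite -?gmulfM ?ee // gmulfM wreath_mulE.
Qed.

Fact stepTM t t' : stepT (t * t') = stepT t * stepT t'.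
Proof.
apply/ffunP=> d; rewrite wreath_mulE !ffunE.
case: d => [[[c|[b|]] []]|b] //=;
  by rewrite -?gmulfM ?ee // gmulfM wreath_mulE.
Qed.

Definition stepS_hom : {multiplicative S -> wreath letter FP} :=
  HB.pack stepS (isMultiplicative.Build _ _ stepS stepSM).

Definition stepT_hom : {multiplicative T -> wreath letter FP} :=
  HB.pack stepT (isMultiplicative.Build _ _ stepT stepTM).

Variable rho : {multiplicative FP -> wreath letter FP}.
Hypothesis rho_inS : rho \o inS =1 stepS.
Hypothesis rho_inT : rho \o inT =1 stepT.

(** ** Words read by one syllable *)

Definition at_phase k (cs : seq content) : seq letter :=
  [seq inl (c, k) | c <- cs].

Definition blockS (a : seq DS) : seq content :=
  rcons [seq inl (Some x) | x <- a] (inl None).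
Definition blockT (b : seq DT) : seq content :=
  rcons [seq inr (Some x) | x <- b] (inr None).

Local Notation runs := (runs rho).

Lemma rho_S s d : rho (inS s) d = stepS s d. Proof. by rewrite -rho_inS. Qed.
Lemma rho_T t d : rho (inT t) d = stepT t d. Proof. by rewrite -rho_inT. Qed.

Lemma runs_fixed s (k k' : phase) cs :
  (forall c, c \in cs -> rho s (inl (c, k)) = (inl (c, k'), s)) ->
  runs s (at_phase k cs) (at_phase k' cs) s.
Proof.
elim: cs => [|c cs IHcs] fixd; first by [].
have [|actE sectE] := IHcs.
  by move=> c' c'cs; apply: fixd; rewrite inE c'cs orbT.
by split; rewrite /= fixd ?mem_head // ?actE ?sectE.
Qed.

Lemma runsS_passive s (k : phase) cs : nextS k <> InS ->
  runs (inS s) (at_phase k cs) (at_phase (nextS k) cs) (inS s).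
Proof. by move=> kP; apply: runs_fixed => c _; rewrite rho_S ffunE; case: k kP. Qed.

Lemma runsT_passive t (k : phase) cs : nextT k <> InT ->
  runs (inT t) (at_phase k cs) (at_phase (nextT k) cs) (inT t).
Proof. by move=> kP; apply: runs_fixed => c _; rewrite rho_T ffunE; case: k kP. Qed.

Lemma runsS_foreign s k b :
  runs (inS s) (at_phase k (blockT b)) (at_phase (nextS k) (blockT b)) (inS s).
Proof.
apply: runs_fixed => c; rewrite rho_S ffunE mem_rcons inE.
by case/predU1P=> [-> | /mapP[x _ ->]]; case: k.
Qed.

Lemma runsT_foreign t k a :
  runs (inT t) (at_phase k (blockS a)) (at_phase (nextT k) (blockS a)) (inT t).
Proof.
apply: runs_fixed => c; rewrite rho_T ffunE mem_rcons inE.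
by case/predU1P=> [-> | /mapP[x _ ->]]; case: k.
Qed.

Lemma runsS_active s k a : nextS k = InS ->
  runs (inS s) (at_phase k (blockS a))
       (at_phase InS (blockS (act rS s a))) (inS e).
Proof.
move=> kS; elim: a s => [|x a IHa] s.
  by split; rewrite /= rho_S ffunE kS.
by have [actE sectE] := IHa (rS s x).2; split;
  rewrite /= rho_S ffunE kS /= ?actE ?sectE.
Qed.

Lemma runsT_active t k b : nextT k = InT ->
  runs (inT t) (at_phase k (blockT b))
       (at_phase InT (blockT (act rT t b))) (inS e).
Proof.
move=> kT; elim: b t => [|x b IHb] t.
  by split; rewrite /= rho_T ffunE kT.
by have [actE sectE] := IHb (rT t x).2; split;
  rewrite /= rho_T ffunE kT /= ?actE ?sectE.
Qed.

(** ** Alternating products *)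

(** [x * t1 * s1 * t2 * s2 * ...], with [o] as an optional last syllable in
    [T]; multiplying on the right lets the head [x] vary freely. *)
Fixpoint extend (x : FP) (L : seq (T * S)) (o : option T) : FP :=
  match L with
  | [::] => if o is Some t then x * inT t else x
  | (t, s) :: L' => extend (x * inT t * inS s) L' o
  end.

Lemma mul_extend y x L o : y * extend x L o = extend (y * x) L o.
Proof.
elim: L x => [|[t s] L IHL] x /=; last by rewrite IHL !mulgA.
by case: o => // t; rewrite mulgA.
Qed.

Inductive alternating : FP -> Prop :=
| StartS s L o : alternating (extend (inS s) L o)
| OnlyT t : alternating (inT t)
| StartT t s L o : alternating (extend (inT t * inS s) L o).

Lemma alternatingP x : alternating x.
Proof.
elim/free_product_ind: x =>
  [s | t | s _ [s' L o | t | t s' L o] | t _ [s L o | t' | t' s L o]].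
- exact: (StartS s [::] None).
- exact: OnlyT.
- by rewrite mul_extend -free_inlM; apply: StartS.
- exact: (StartS s [::] (Some t)).
- by rewrite mul_extend mulgA; apply: (StartS s ((t, s') :: L) o).
- by rewrite mul_extend; apply: StartT.
- by rewrite -free_inrM; apply: OnlyT.
- by rewrite mul_extend mulgA -free_inrM; apply: StartT.
Qed.

Definition past k := if k is InS then true else if k is After then true else false.

(** Once [x] has left the letters in phase [InS] or [After], every later
    syllable finds them inert and keeps itself as section: the next one is in
    [T], and moves them to [After]. *)
Lemma runs_extend x w k cs x' L o : past k ->
  runs x w (at_phase k cs) x' ->
  exists2 k', past k' & runs (extend x L o) w (at_phase k' cs) (extend x' L o).
Proof.
have runsT k0 y y' t : past k0 -> runs y w (at_phase k0 cs) y' ->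
    runs (y * inT t) w (at_phase After cs) (y' * inT t).
  by move=> k0P yw; apply: (runsM yw); case: k0 k0P {yw} => // _;
    apply: runsT_passive.
elim: L k x x' => [|[t s] L IHL] k x x' kP xw /=.
  case: o => [t|]; last by exists k.
  by exists After => //; apply: runsT xw.
apply: (IHL After) => //.
exact: runsM (runsT _ _ _ _ kP xw) (runsS_passive _ _ _).
Qed.

(** Blocks end with a separator, hence are non-empty and show their phase. *)
Lemma at_phase_inj (k k' : phase) cs cs' c c' :
  at_phase k (rcons cs c) = at_phase k' (rcons cs' c') ->
  k = k' /\ rcons cs c = rcons cs' c'.
Proof.
move=> eq_cs; split.
  have := congr1 (last (inr None)) eq_cs.
  by rewrite /at_phase !map_rcons !last_rcons => -[].
pose content_of (d : letter) : content := if d is inl p then p.1 else inr None.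
have atK k0 : cancel (at_phase k0) (map content_of).
  by move=> cs0; rewrite -map_comp map_id.
by rewrite -[LHS](atK k) eq_cs atK.
Qed.

Lemma blockS_inj : injective blockS.
Proof.
move=> a a' /eqP; rewrite eqseq_rcons eqxx andbT => /eqP.
by apply: inj_map => x y [].
Qed.

Lemma blockT_inj : injective blockT.
Proof.
move=> a a' /eqP; rewrite eqseq_rcons eqxx andbT => /eqP.
by apply: inj_map => x y [].
Qed.

Hypothesis faithS : faithful rS.
Hypothesis faithT : faithful rT.

(** ** Recovering the syllables *)

(** The syllables [e] and [t] take the letters to phases [Before] and [InT]
    without acting, so the action of [s] becomes visible. *)
Lemma runsS_word t s L o a : exists2 k, past k &
  runs (extend (inS e) ((t, s) :: L) o) (at_phase Before (blockS a))
       (at_phase k (blockS (act rS s a))) (extend (inS e * inT t * inS e) L o).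
Proof.
rewrite [extend _ (_ :: _) _]/=; apply: (@runs_extend _ _ InS) => //.
apply: runsM (runsS_active s a (erefl : nextS InT = _)).
by apply: runsM (runsT_foreign t Before a); apply: (@runsS_passive e Before).
Qed.

(** Here [t] is the first syllable to act; all of [e * t * e] collapses to
    [e * e * e = e]. *)
Lemma runsT_word t L o b : exists2 k, past k &
  runs (extend (inS e * inT t * inS e) L o) (at_phase Before (blockT b))
       (at_phase k (blockT (act rT t b))) (extend (inS e) L o).
Proof.
apply: (@runs_extend _ _ InS) => //.
have eee : inS e * inS e * inS e = inS e by rewrite -!free_inlM !ee.
rewrite -[X in runs _ _ _ X]eee; apply: runsM (runsS_foreign e InT _).
apply: runsM (runsT_active t b (erefl : nextT Before = _)).
exact: (runsS_foreign e Before).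
Qed.

Lemma runsS_single t a :
  runs (extend (inS e) [::] (Some t)) (at_phase Before (blockS a))
       (at_phase InT (blockS a)) (inS e * inT t).
Proof.
by apply: runsM (runsT_foreign t Before a); apply: (@runsS_passive e Before).
Qed.

Lemma runsT_single t b :
  runs (extend (inS e) [::] (Some t)) (at_phase Before (blockT b))
       (at_phase InT (blockT (act rT t b))) (inS e * inS e).
Proof.
apply: runsM (runsT_active t b (erefl : nextT Before = _)).
exact: (runsS_foreign e Before).
Qed.

Lemma runsS_none a : runs (extend (inS e) [::] None) (at_phase Before (blockS a))
  (at_phase Before (blockS a)) (inS e).
Proof. exact: (@runsS_passive e Before). Qed.

(** The induction that peels off one syllable of [T] and one of [S] at a time.
    Words with at most one further syllable are told apart from the others by
    the phase in which they leave a block. *)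
Lemma faithful_extend L o L' o' :
  act rho (extend (inS e) L o) =1 act rho (extend (inS e) L' o') ->
  L = L' /\ o = o'.
Proof.
elim: L o L' o' => [|[t s] L IHL] o [|[t' s'] L'] o'.
- case: o o' => [t|] [t'|] // eq_act.
  + have eqT b : act rT t b = act rT t' b.
      have [/at_phase_inj[_ /blockT_inj //] _] :=
        kernel_section eq_act (runsT_single t b) (runsT_single t' b).
    by rewrite (faithT eqT).
  + by have [/at_phase_inj[]] :=
      kernel_section eq_act (runsS_single t [::]) (runsS_none [::]).
  + by have [/at_phase_inj[]] :=
      kernel_section eq_act (runsS_none [::]) (runsS_single t' [::]).
- move=> eq_act; have [k kP run'] := runsS_word t' s' L' o' [::].
  case: o eq_act => [t|] eq_act.
    by have [/at_phase_inj[kE]] := kernel_section eq_act (runsS_single t [::]) run';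
      rewrite -kE in kP.
  by have [/at_phase_inj[kE]] := kernel_section eq_act (runsS_none [::]) run';
    rewrite -kE in kP.
- move=> eq_act; have [k kP run] := runsS_word t s L o [::].
  case: o' eq_act => [t'|] eq_act.
    by have [/at_phase_inj[kE]] := kernel_section eq_act run (runsS_single t' [::]);
      rewrite kE in kP.
  by have [/at_phase_inj[kE]] := kernel_section eq_act run (runsS_none [::]);
    rewrite kE in kP.
move=> eq_act.
have eqS a : act rS s a = act rS s' a.
  have [k _ run] := runsS_word t s L o a;
  have [k' _ run'] := runsS_word t' s' L' o' a.
  by have [/at_phase_inj[_ /blockS_inj]] := kernel_section eq_act run run'.
have {}eq_act : act rho (extend (inS e * inT t * inS e) L o) =1
               act rho (extend (inS e * inT t' * inS e) L' o').
  have [k _ run] := runsS_word t s L o [::];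
  have [k' _ run'] := runsS_word t' s' L' o' [::].
  by have [] := kernel_section eq_act run run'.
have eqT b : act rT t b = act rT t' b.
  have [k _ run] := runsT_word t L o b;
  have [k' _ run'] := runsT_word t' L' o' b.
  by have [/at_phase_inj[_ /blockT_inj]] := kernel_section eq_act run run'.
have [k _ run] := runsT_word t L o [::];
have [k' _ run'] := runsT_word t' L' o' [::].
have [_ /IHL[-> ->]] := kernel_section eq_act run run'.
by rewrite (faithS eqS) (faithT eqT).
Qed.

Definition probe : seq letter := [:: inr None].
Definition probed (isS : bool) : seq letter := [:: inr (Some isS)].

Lemma runs_probedS s b : runs (inS s) (probed b) (probed b) (inS s).
Proof. by split; rewrite /= rho_S ffunE. Qed.

Lemma runs_probedT t b : runs (inT t) (probed b) (probed b) (inT t).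
Proof. by split; rewrite /= rho_T ffunE. Qed.

Lemma runs_probeS s : runs (inS s) probe (probed true) (inS s).
Proof. by split; rewrite /= rho_S ffunE. Qed.

Lemma runs_probeT t : runs (inT t) probe (probed false) (inT t).
Proof. by split; rewrite /= rho_T ffunE. Qed.

Lemma runs_probe_extend x b L o : runs x probe (probed b) x ->
  runs (extend x L o) probe (probed b) (extend x L o).
Proof.
elim: L x => [|[t s] L IHL] x xP /=.
  by case: o => // t; apply: runsM xP (runs_probedT _ _).
by apply/IHL/runsM/runs_probedS/runsM/runs_probedT.
Qed.

Lemma faithful_free_product : faithful rho.
Proof.
have firstS s L o := runs_probe_extend L o (runs_probeS s).
have firstT t s L o :=
  runs_probe_extend L o (runsM (runs_probeT t) (runs_probedS s false)).
have extendT t s L o :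
    inS e * extend (inT t * inS s) L o = extend (inS e) ((t, s) :: L) o.
  by rewrite mul_extend mulgA.
move=> x y eq_act.
have eq_probe b b' : runs x probe (probed b) x -> runs y probe (probed b') y ->
    b = b'.
  by move=> xb yb; case: (kernel_section eq_act xb yb) => -[].
have eq_eact : act rho (inS e * x) =1 act rho (inS e * y).
  by move=> w; rewrite !actM eq_act.
case: (alternatingP x) (alternatingP y) eq_act eq_probe eq_eact =>
    [s L o | t | t s L o] [s' L' o' | t' | t' s' L' o'] eq_act eq_probe eq_eact.
(* Both start in [S]: a block in phase [InT] shows the first syllable. *)
- have reveal (s0 : S) L0 o0 a := @runs_extend _ _ InS _ _ L0 o0 isT
    (runsS_active s0 a (erefl : nextS InT = _)).
  have eqS a : act rS s a = act rS s' a.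
    have [k _ run] := reveal s L o a; have [k' _ run'] := reveal s' L' o' a.
    by have [/at_phase_inj[_ /blockS_inj]] := kernel_section eq_act run run'.
  have [k _ run] := reveal s L o [::]; have [k' _ run'] := reveal s' L' o' [::].
  have [_ /faithful_extend[-> ->]] := kernel_section eq_act run run'.
  by rewrite (faithS eqS).
- by have := eq_probe _ _ (firstS _ _ _) (runs_probeT _).
- by have := eq_probe _ _ (firstS _ _ _) (firstT _ _ _ _).
- by have := eq_probe _ _ (runs_probeT _) (firstS _ _ _).
(* Both start in [T]: multiplying by [e] loses nothing. *)
- by have [_ [->]] := @faithful_extend [::] (Some t) [::] (Some t') eq_eact.
- by move: eq_eact; rewrite extendT => /(@faithful_extend [::] (Some t))[].
- by have := eq_probe _ _ (firstT _ _ _ _) (firstS _ _ _).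
- by move: eq_eact; rewrite extendT => /(@faithful_extend _ _ [::] (Some t'))[].
- by move: eq_eact; rewrite !extendT => /faithful_extend[[-> -> ->] ->].
Qed.

(** Apart from sections in the factors, only [e] occurs. *)
Lemma section_closed_free_product (QS : seq S) (QT : seq T) :
  e \in QS -> section_closed rS QS -> section_closed rT QT ->
  section_closed rho ([seq inS s | s <- QS] ++ [seq inT t | t <- QT]).
Proof.
move=> eQS closedS closedT.
set Q := _ ++ _.
have QinS q : q \in QS -> inS q \in Q by move=> Qq; rewrite mem_cat map_f.
have QinT q : q \in QT -> inT q \in Q.
  by move=> Qq; rewrite mem_cat (map_f _ Qq) orbT.
move=> x d; rewrite {1}mem_cat => /orP[] /mapP[q Qq ->].
  rewrite rho_S ffunE.
  by case: d => [[[[a|]|c] []]|b]; apply: QinS => //; apply: closedS.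
rewrite rho_T ffunE; case: d => [[[c|[b|]] []]|b];
  by [apply: QinT => //; apply: closedT | apply: QinS].
Qed.

End FreeProduct.

Theorem theorem3 (S T : semigroupType)
    (autS : is_automaton_semigroup S) (autT : is_automaton_semigroup T)
    (idemS : has_idempotent S) (idemT : has_idempotent T) :
  is_automaton_semigroup (free_product S T).
Proof.
have [DS [rS [QS [genS closedS faithS]]]] := automaton_self_similar autS.
have [DT [rT [QT [genT closedT faithT]]]] := automaton_self_similar autT.
have [e ee] := idemS.
have [Qe eQe closedQe] := section_closed_ext genS closedS e.
have [[rho [rhoS rhoT]] _] :=
  free_product_coproduct (stepS_hom T DT rS ee) (stepT_hom DS rT ee).
apply: self_similar_automaton; exists (letter DS DT), rho.
exists ([seq free_inl T s | s <- QS ++ Qe] ++ [seq free_inr S t | t <- QT]); split.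
- apply: free_product_generates => // P P1 PM.
  by apply: genS => [q Qq | q s Qq]; [apply: P1 | apply: PM]; rewrite mem_cat Qq.
- apply: (section_closed_free_product rhoS rhoT) => //.
    by rewrite mem_cat eQe orbT.
  move=> q d; rewrite !mem_cat => /orP[/closedS | /closedQe] -> //.
  by rewrite orbT.
- exact: (faithful_free_product ee rhoS rhoT).
Qed.
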